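(* Let $(\alpha|\beta)\in\mathscr P^2(n)$. The signed Young permutation module $M(\alpha|\beta)$ is indecomposable if and only if one of the following holds: (i) $(\alpha|\beta)=((m)|(n'))$ for non-negative integers $m,n'$ with $m+n'=n$ (where $(0)$ means $\varnothing$) such that either (a) $m=0$, (b) $n'=0$, or (c) $p$ divides $m+n'$; (ii) $(\alpha|\beta)$ is $((kp-1,1)|\varnothing)$ or $(\varnothing|(kp-1,1))$ for some $k\in\mathbb N$. In cases (i)(a) and (i)(b), $\mathrm{End}_{F\mathfrak S_n}M(\alpha|\beta)\cong F$; in all remaining cases $\mathrm{End}_{F\mathfrak S_n}M(\alpha|\beta)\cong F[x]/\langle x^2\rangle$.
   Context: $F$ is a field of odd prime characteristic $p$; $\mathfrak S_n$ is the symmetric group on $\{1,\dots,n\}$. $\mathscr P^2(n)$ is the set of pairs $(\alpha|\beta)$ of partitions (possibly empty, $\varnothing$) with $|\alpha|+|\beta|=n$. $M(\alpha|\beta)=\mathrm{Ind}_{\mathfrak S_\alpha\times\mathfrak S_\beta}^{\mathfrak S_n}(F\boxtimes\mathrm{sgn})$, where $\mathfrak S_\alpha=\mathfrak S_{\alpha_1}\times\mathfrak S_{\alpha_2}\times\cdots$ is the Young subgroup permuting $\{1,\dots,|\alpha|\}$ (in consecutive blocks) acting trivially, and $\mathfrak S_\beta$ is the Young subgroup of $\{|\alpha|+1,\dots,n\}$ acting by the sign character. *)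

(* Defs.v *)
From HB Require Import structures.
From mathcomp Require Import all_boot all_order all_algebra all_fingroup all_character.
Set Implicit Arguments. Unset Strict Implicit. Unset Printing Implicit Defensive.
Import GRing.Theory.
Local Open Scope ring_scope.

Definition is_partition (s : seq nat) : bool :=
  sorted geq s && all (fun x => 0 < x)%N s.

Definition row_part (m : nat) : seq nat := if m == 0%N then [::] else [:: m].

(* Index of the consecutive block (of the composition c) containing
   position i (positions are 0-based, i.e. {1..n} is 'I_n). *)
Definition blk (c : seq nat) (i : nat) : nat :=
  count (fun k => sumn (take k.+1 c) <= i)%N (iota 0 (size c)).

Section SignedYoung.
Variables (F : fieldType) (n : nat) (alpha beta : seq nat).

Local Notation c := (alpha ++ beta).
Local Notation a := (sumn alpha).

Definition YoungA : {set 'S_n} :=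
  [set s : 'S_n | [forall i : 'I_n,
     (blk c (s i) == blk c i) && ((a <= i)%N ==> (s i == i))]].

Definition YoungB : {set 'S_n} :=
  [set s : 'S_n | [forall i : 'I_n,
     (blk c (s i) == blk c i) && ((i < a)%N ==> (s i == i))]].

Definition SymG : {group 'S_n} := [set: 'S_n]%G.

Definition gelt (x : 'S_n) : 'rV[F]_#|SymG| := delta_mx 0 (gring_index SymG x).

Definition young_elt : 'rV[F]_#|SymG| :=
  \sum_(x in YoungA) \sum_(y in YoungB) (-1) ^+ (odd_perm y) *: gelt (x * y).

(* M(alpha|beta) realized as the cyclic submodule e.FS_n of the regular
   module; e.FS_n is the induced module from S_alpha x S_beta of
   triv (x) sgn (mathcomp representations act on row vectors, i.e. on the
   right). *)
Definition Mrep :=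
  submod_repr (cyclic_mx_module (regular_repr F SymG) young_elt).

End SignedYoung.

Section Modules.
Variables (F : fieldType) (gT : finGroupType) (G : {group gT}) (d : nat).
Variable rG : mx_representation F G d.

Definition mx_indecomposable : Prop :=
  (0 < d)%N /\
  forall U V : 'M[F]_d, mxmodule rG U -> mxmodule rG V ->
    mxdirect (U + V) -> (U + V == 1%:M)%MS -> U = 0 \/ V = 0.

Definition End_iso_F : Prop :=
  forall f : 'M[F]_d, centgmx rG f -> exists c : F, f = c%:M.

(* End_{FG}(M) = F[x]/(x^2): it has F-basis {1, N} with N^2 = 0, N <> 0. *)
Definition End_iso_dual : Prop :=
  exists N : 'M[F]_d, [/\ centgmx rG N, N != 0, N *m N = 0 &
    forall f : 'M[F]_d, centgmx rG f -> exists c b : F, f = c%:M + b *: N].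
End Modules.

(* Main.v *)
Require Import Defs.
From HB Require Import structures.
From mathcomp Require Import all_boot all_order all_algebra all_fingroup all_character.
From mathcomp Require Import zify ring.
Import GRing.Theory.
Local Open Scope ring_scope.

(** The module is e.FG for e = sum of chi(h) h over the Young subgroup H, and e.FG
    consists of the functions f on G with f(hg) = chi(h) f(g).  For two blocks of
    sizes a and b, left multiplication by the sum z of all transpositions
    exchanging a point of one with a point of the other is an endomorphism.

    If both blocks carry the same character, z has, up to sign, the Johnson
    scheme eigenvalues ab, ab - (a + b) and, when a, b >= 2, ab - 2(a + b) + 2.  If
    one is trivial and the other signed, (z - a)(z + b) = 0 on e.FG.  Two distinct
    eigenvalues split the module, so indecomposability forces p | a + b for every
    pair of blocks, and a = 1 or b = 1 when the characters agree; as p is odd, only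
    the listed shapes survive.

    Conversely, when H has two blocks of different types, a function that is
    chi-equivariant on both sides is determined by its values at 1 and at one
    transposition outside H, so that End is spanned by 1 and z + b, and
    (z + b)^2 = (a + b)(z + b) = 0 when p | a + b. *)

Set Implicit Arguments. Unset Strict Implicit. Unset Printing Implicit Defensive.

(** * Endomorphisms and decompositions *)

Section Endomorphisms.
Variables (F : fieldType) (gT : finGroupType) (G : {group gT}) (d : nat).
Variable rG : mx_representation F G d.

(** Factor the minimal polynomial of [f] as [q] times a power of X - m1, with m1 not a root of [q].
    The kernels of the two coprime factors are complementary submodules because [f] commutes with G;
    one contains [v1] and the other, since m2 is a root of [q], contains [v2]. *)
Lemma not_indecomposable_eigenvectors (f : 'M[F]_d) (v1 v2 : 'rV[F]_d) (m1 m2 : F) :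
  centgmx rG f -> v1 != 0 -> v2 != 0 -> v1 *m f = m1 *: v1 ->
  v2 *m f = m2 *: v2 -> m1 != m2 -> ~ mx_indecomposable rG.
Proof.
move=> cf nz1 nz2 ev1 ev2 neq [_ indec].
case: d rG f v1 v2 cf nz1 nz2 ev1 ev2 indec => [|d'] r f v1 v2 cf nz1 nz2 ev1 ev2 indec.
  by rewrite thinmx0 eqxx in nz1.
have [k [q nrq defp]] := multiplicity_XsubC (mxminpoly f) m1.
have mp_nz : mxminpoly f != 0 by rewrite monic_neq0 ?mxminpoly_monic.
rewrite mp_nz /= in nrq.
have ev_min m (v : 'rV_d'.+1) : v != 0 -> v *m f = m *: v -> root (mxminpoly f) m.
  move=> nzv ev; rewrite -eigenvalue_root_min.
  by apply/eigenvalueP; exists v.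
have rootq : root q m2.
  have := ev_min _ _ nz2 ev2; rewrite defp rootM => /orP[//|].
  move=> r2; case: (k) r2 => [|k']; first by rewrite expr0 (negPf (root1 _)).
  by rewrite root_exp_XsubC eq_sym (negPf neq).
have kgt0 : (0 < k)%N.
  have := ev_min _ _ nz1 ev1; rewrite defp rootM (negPf nrq) /=.
  by case: (k) => //; rewrite expr0 (negPf (root1 _)).
have hv m (v : 'rV_d'.+1) (s : {poly F}) : v *m f = m *: v -> v *m horner_mx f s = s.[m] *: v.
  move=> ev; elim/poly_ind: s => [|s c IHs].
    by rewrite rmorph0 horner0 scale0r mulmx0.
  rewrite !hornerE rmorphD rmorphM /= horner_mx_X horner_mx_C scalerDl.
  by rewrite -scalerA mulmxDr mul_mx_scalar mulmxA IHs -scalemxAl ev.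
have cop : coprimep q (('X - m1%:P) ^+ k).
  by rewrite coprimep_expr // coprimep_XsubC.
have modk s : mxmodule r (kermxpoly f s).
  apply: kermx_centg_module; apply/centgmxP => x Gx.
  by apply/comm_mx_sym/comm_mx_horner/comm_mx_sym/(centgmxP cf).
have [] := indec _ _ (modk q) (modk (('X - m1%:P) ^+ k)).
- by apply/mxdirect_addsP; rewrite mxdirect_kermxpoly.
- rewrite -!(kermxpolyM _ cop) -defp.
  by apply/eqmxP; apply: kermxpoly_min.
- move=> k0; case/negP: nz2; rewrite -submx0 -k0; apply/sub_kermxP.
  by rewrite (hv _ _ _ ev2) (eqP rootq) scale0r.
- move=> k0; case/negP: nz1; rewrite -submx0 -k0; apply/sub_kermxP.
  rewrite (hv _ _ _ ev1) horner_exp hornerXsubC subrr expr0n.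
  by rewrite eqn0Ngt kgt0 scale0r.
Qed.

(** The projection onto U along V is an idempotent endomorphism; being 0 or 1 it kills U or V. *)
Lemma indecomposable_idempotents : (0 < d)%N ->
  (forall P : 'M[F]_d, centgmx rG P -> P *m P = P -> P = 0 \/ P = 1%:M) ->
  mx_indecomposable rG.
Proof.
move=> dgt0 idem; split=> // U V modU modV /mxdirect_addsP UV0 UV1.
have cP : centgmx rG (proj_mx U V).
  apply/centgmxP => x Gx; have := proj_mx_hom UV0 modU modV.
  rewrite (eqmxP UV1) => /hom_mxP /(_ x Gx).
  by rewrite !mul1mx.
have PP : proj_mx U V *m proj_mx U V = proj_mx U V.
  by rewrite proj_mx_id // -[X in (X <= _)%MS]mul1mx proj_mx_sub.
case: (idem _ cP PP) => eqP; [left|right].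
  by rewrite -(proj_mx_id UV0 (submx_refl U)) eqP mulmx0.
by rewrite -(proj_mx_0 UV0 (submx_refl V)) eqP mulmx1.
Qed.

Lemma End_iso_F_indecomposable : (0 < d)%N -> End_iso_F rG -> mx_indecomposable rG.
Proof.
move=> dgt0 EF; apply: indecomposable_idempotents => // P /EF[c ->].
case: d dgt0 => // d' _; rewrite -scalar_mxM => /matrixP/(_ 0 0).
rewrite !mxE eqxx !mulr1n => /eqP.
rewrite -subr_eq0 -{3}[c]mulr1 -mulrBr mulf_eq0 subr_eq0 => /orP[] /eqP ->.
  by left; rewrite raddf0.
by right.
Qed.

Lemma End_iso_dual_indecomposable : End_iso_dual rG -> mx_indecomposable rG.
Proof.
case=> N [cN nzN NN EF]; apply: indecomposable_idempotents.
  by case: d N nzN {cN NN EF} => // N; rewrite thinmx0 eqxx.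
move=> P /EF[c [b ->]] idem.
have sqE : (c%:M + b *: N) *m (c%:M + b *: N) = (c * c)%:M + (c * b + c * b) *: N.
  rewrite mulmxDl !mulmxDr -scalar_mxM mul_scalar_mx mul_mx_scalar.
  by rewrite -scalemxAl -scalemxAr NN !scaler0 addr0 !scalerA scalerDl addrA.
rewrite sqE in idem.
have cc : c * c = c.
  (* Multiplying by [N] removes the [N] terms and leaves c^2 N = c N. *)
  have := congr1 (mulmx N) idem; rewrite !mulmxDr !mul_mx_scalar -!scalemxAr NN.
  rewrite !scaler0 !addr0 => /eqP; rewrite -subr_eq0 -scalerBl scaler_eq0.
  by rewrite (negPf nzN) orbF subr_eq0 => /eqP.
have b0 : b = 0.
  move/eqP: idem; rewrite cc (inj_eq (addrI _)) -subr_eq0 -scalerBl scaler_eq0.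
  rewrite (negPf nzN) orbF => /eqP eb.
  (* Since c^2 = c, the factor 2c - 1 squares to 1, so (2c - 1) b = 0 forces b = 0 in any
     characteristic. *)
  have : (c + c - 1) * (c * b + c * b - b) = 0 by rewrite eb mulr0.
  rewrite (_ : _ * _ = (c * c - c) * b *+ 4 + b); last by ring.
  by rewrite cc subrr mul0r mul0rn add0r.
move/eqP: cc; rewrite -subr_eq0 -{3}[c]mulr1 -mulrBr mulf_eq0 subr_eq0 b0 scale0r addr0.
case/orP=> /eqP ->; first by left; rewrite raddf0.
by right.
Qed.
End Endomorphisms.

Section SubmoduleEndomorphisms.
Variables (F : fieldType) (gT : finGroupType) (G : {group gT}) (d : nat).
Variable rG : mx_representation F G d.

(** [submod_repr] acts on coordinates relative to a basis of U, so an operator on the ambient space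
    has to be rewritten in that basis. *)
Definition restr_submod (U Z : 'M[F]_d) : 'M[F]_(\rank U) :=
  in_submod U (val_submod 1%:M *m Z).

Lemma restr_submodE m (U Z : 'M[F]_d) (W : 'M[F]_(m, d)) : (W <= U)%MS ->
  in_submod U W *m restr_submod U Z = in_submod U (W *m Z).
Proof.
move=> WU; rewrite /restr_submod [in_submod U (_ *m Z)]in_submodE -[_ *m Z *m _]mulmxA.
rewrite [LHS]mulmxA -[in_submod U W *m _]val_submodE in_submodK //.
by rewrite mulmxA -in_submodE.
Qed.

Lemma restr_submod_centg (U Z : 'M[F]_d) (Umod : mxmodule rG U) :
  (forall x, x \in G -> Z *m rG x = rG x *m Z) -> (U *m Z <= U)%MS ->
  centgmx (submod_repr Umod) (restr_submod U Z).
Proof.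
move=> cZ stabZ; apply/centgmxP => x Gx.
have val1 := val_submodP (1%:M : 'M_(\rank U)).
transitivity (in_submod U (val_submod (1%:M : 'M_(\rank U)) *m Z *m rG x)).
  rewrite (in_submodJ Umod) //.
  by apply: submx_trans stabZ; apply: submxMr.
rewrite /= /submod_mx restr_submodE ?mxmodule_trans //.
by congr (in_submod U _); rewrite -!mulmxA cZ.
Qed.

Lemma not_indecomposable_submod (U Z : 'M[F]_d) (Umod : mxmodule rG U)
    (v1 v2 : 'rV[F]_d) (m1 m2 : F) :
  (forall x, x \in G -> Z *m rG x = rG x *m Z) -> (U *m Z <= U)%MS ->
  (v1 <= U)%MS -> (v2 <= U)%MS -> v1 != 0 -> v2 != 0 ->
  v1 *m Z = m1 *: v1 -> v2 *m Z = m2 *: v2 -> m1 != m2 ->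
  ~ mx_indecomposable (submod_repr Umod).
Proof.
move=> cZ stabZ v1U v2U nz1 nz2 ev1 ev2 neq.
have nz (v : 'rV_d) : (v <= U)%MS -> v != 0 -> in_submod U v != 0.
  by move=> vU; apply: contraNneq => v0; rewrite -(in_submodK vU) v0 linear0.
have ev (v : 'rV_d) m : (v <= U)%MS -> v *m Z = m *: v ->
    in_submod U v *m restr_submod U Z = m *: in_submod U v.
  by move=> vU evv; rewrite restr_submodE // evv linearZ.
apply: (not_indecomposable_eigenvectors (restr_submod_centg Umod cZ stabZ)
  (nz _ v1U nz1) (nz _ v2U nz2) (ev _ _ v1U ev1) (ev _ _ v2U ev2) neq).
Qed.

(** Every vector of the module is [u] times a combination of group elements, so an endomorphism is
    determined by the image of [u]. *)
Lemma cyclic_endo_eq (u : 'rV[F]_d)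
    (f g : 'M[F]_(\rank (cyclic_mx rG u))) :
  centgmx (submod_repr (cyclic_mx_module rG u)) f ->
  centgmx (submod_repr (cyclic_mx_module rG u)) g ->
  in_submod (cyclic_mx rG u) u *m f = in_submod (cyclic_mx rG u) u *m g -> f = g.
Proof.
move=> /centgmxP cf /centgmxP cg efg; apply/row_matrixP => i.
rewrite !rowE; set w := delta_mx 0 i.
have /cyclic_mxP[A /envelop_mxP[a ->] defw] := val_submodP w.
rewrite -[w]val_submodK defw mulmx_sumr linear_sum !mulmx_suml.
apply: eq_bigr => x Gx; rewrite -scalemxAr linearZ -!scalemxAl; congr (_ *: _).
rewrite -[_ (u *m _)]/(in_submod (cyclic_mx rG u) _).
rewrite !(in_submodJ (cyclic_mx_module rG u)) ?cyclic_mx_id //.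
have := cf x Gx; have := cg x Gx; rewrite /= => cgx cfx.
rewrite -![in_submod _ u *m _ *m _]mulmxA -cfx -cgx.
by rewrite ![in_submod _ u *m (_ *m _)]mulmxA efg.
Qed.
End SubmoduleEndomorphisms.

(** * The group algebra as functions on the symmetric group *)

Section GroupAlgebra.
Variables (F : fieldType) (n : nat).
Local Notation G := (SymG n).
Local Notation FG := ('rV[F]_#|G|).
Local Notation reg := (regular_repr F G).

Definition gcoef (v : FG) (g : 'S_n) : F := v 0 (gring_index G g).
Definition gvec (f : 'S_n -> F) : FG := \row_i f (enum_val i).

Lemma in_SymG (g : 'S_n) : g \in G. Proof. exact: in_setT. Qed.

Lemma gcoef_gvec f : gcoef (gvec f) =1 f.
Proof. by move=> g; rewrite /gcoef mxE gring_indexK ?in_SymG. Qed.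

Lemma gcoefP (v w : FG) : gcoef v =1 gcoef w -> v = w.
Proof. by move=> eq_vw; apply/rowP => i; rewrite -[i]gring_valK; apply: eq_vw. Qed.

Lemma gcoefD v w g : gcoef (v + w) g = gcoef v g + gcoef w g.
Proof. by rewrite /gcoef mxE. Qed.

Lemma gcoefZ a v g : gcoef (a *: v) g = a * gcoef v g.
Proof. by rewrite /gcoef mxE. Qed.

Lemma gcoef0 g : gcoef 0 g = 0.
Proof. by rewrite /gcoef mxE. Qed.

Lemma gcoef_sum (I : finType) (P : pred I) (v : I -> FG) g :
  gcoef (\sum_(i | P i) v i) g = \sum_(i | P i) gcoef (v i) g.
Proof. by rewrite /gcoef summxE. Qed.

Lemma gcoef_gelt x g : gcoef (gelt F x) g = (x == g)%:R.
Proof.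
rewrite /gcoef mxE eqxx /= -(inj_eq (@enum_val_inj _ _)) !gring_indexK ?in_SymG //.
by rewrite eq_sym.
Qed.

Lemma sum_gring (f : 'I_#|G| -> F) : \sum_i f i = \sum_(g : 'S_n) f (gring_index G g).
Proof.
apply: (reindex (gring_index G)); exists (@enum_val _ (mem G)) => x _.
  by rewrite gring_indexK ?in_SymG.
by rewrite gring_valK.
Qed.

Lemma gcoef_regular (v : FG) x g : gcoef (v *m reg x) g = gcoef v (g * x^-1)%g.
Proof.
rewrite /gcoef mxE sum_gring (bigD1 (g * x^-1)%g) //= big1 ?addr0 => [|k neq].
  by rewrite !mxE gring_indexK ?in_SymG // mulgKV !eqxx mulr1.
rewrite !mxE eqxx /= -(inj_eq (@enum_val_inj _ _)) !gring_indexK ?in_SymG //.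
have [eg|_] := eqVneq g (k * x)%g; last by rewrite mulr0.
by rewrite eg mulgK eqxx in neq.
Qed.

(* Acts as left multiplication by t^-1. *)
Definition lmulg (t : 'S_n) : 'M[F]_#|G| :=
  \matrix_(i, j) (enum_val i == t * enum_val j)%g%:R.

Lemma gcoef_lmulg (v : FG) t g : gcoef (v *m lmulg t) g = gcoef v (t * g)%g.
Proof.
rewrite /gcoef mxE sum_gring (bigD1 (t * g)%g) //= big1 ?addr0 => [|k neq].
  by rewrite !mxE !gring_indexK ?in_SymG // eqxx mulr1.
by rewrite !mxE !gring_indexK ?in_SymG // (negPf neq) mulr0.
Qed.

Lemma mulmx_ext (A B : 'M[F]_#|G|) : (forall v : FG, v *m A = v *m B) -> A = B.
Proof. by move=> eqAB; apply/row_matrixP => i; rewrite !rowE eqAB. Qed.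

(** For disjoint [A] and [B] this is left multiplication by the sum z of the transpositions between
    them; the inverse hidden in [lmulg] is harmless, as transpositions are involutions. *)
Definition swap_op (A B : {set 'I_n}) : 'M[F]_#|G| :=
  \sum_(x in A) \sum_(y in B) lmulg (tperm x y).

Lemma gcoef_swap A B (v : FG) g :
  gcoef (v *m swap_op A B) g = \sum_(x in A) \sum_(y in B) gcoef v (tperm x y * g)%g.
Proof.
rewrite mulmx_sumr gcoef_sum; apply: eq_bigr => x _.
by rewrite mulmx_sumr gcoef_sum; apply: eq_bigr => y _; rewrite gcoef_lmulg.
Qed.

Lemma swap_op_regular A B x : x \in G -> swap_op A B *m reg x = reg x *m swap_op A B.
Proof.
move=> _; apply: mulmx_ext => v; apply: gcoefP => g.
rewrite !mulmxA gcoef_regular !gcoef_swap; apply: eq_bigr => i _.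
by apply: eq_bigr => j _; rewrite gcoef_regular mulgA.
Qed.

(** * Modules induced from a linear character *)

Section Induced.
Variables (H : {group 'S_n}) (chi : 'S_n -> F).
Hypothesis chi1 : chi 1%g = 1.
Hypothesis chiM : {in H &, forall h k, chi (h * k)%g = chi h * chi k}.

(** As an element of the group algebra this is the sum of chi(h) h over H; as a function it is [chi]
    extended by zero. *)
Definition chi_elt : FG := gvec (fun g => if g \in H then chi g else 0).
Local Notation e := chi_elt.
Local Notation U := (cyclic_mx reg e).

Lemma chi_unit h : h \in H -> chi h * chi h^-1%g = 1.
Proof. by move=> Hh; rewrite -chiM ?groupV // mulgV chi1. Qed.

Lemma chi_elt_mull h g : h \in H -> gcoef e (h * g)%g = chi h * gcoef e g.
Proof.
by move=> Hh; rewrite !gcoef_gvec groupMl //; case: ifP => Hg; rewrite ?mulr0 ?chiM.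
Qed.

Lemma chi_elt_mulr h g : h \in H -> gcoef e (g * h)%g = chi h * gcoef e g.
Proof.
move=> Hh; rewrite !gcoef_gvec groupMr //; case: ifP => Hg; rewrite ?mulr0 ?chiM //.
by rewrite mulrC.
Qed.

Lemma chi_elt_neq0 : e != 0.
Proof.
apply/eqP => /(congr1 (fun v => gcoef v 1%g)); rewrite gcoef0 gcoef_gvec group1 chi1.
by move/eqP; rewrite oner_eq0.
Qed.

(** Right translates of [e] are equivariant under H on the left. Conversely, an equivariant function
    is determined on each coset Hg by its value at a representative, hence is the sum over the
    cosets of that value times the translate of [e] by the representative. *)
Lemma mem_induced (v : FG) :
  (v <= U)%MS <-> (forall h g, h \in H -> gcoef v (h * g)%g = chi h * gcoef v g).
Proof.
split=> [/cyclic_mxP[A /envelop_mxP[a ->] ->] h g Hh|semi].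
  rewrite mulmx_sumr !gcoef_sum mulr_sumr; apply: eq_bigr => x _.
  by rewrite -scalemxAr !gcoefZ !gcoef_regular -mulgA chi_elt_mull // mulrCA.
have -> : v = \sum_(C in rcosets H G) gcoef v (repr C) *: (e *m reg (repr C)).
  apply: gcoefP => g; rewrite gcoef_sum (bigD1 (H :* g)%g) /=; last first.
    by apply/rcosetsP; exists g; rewrite ?in_SymG.
  rewrite big1 ?addr0 => [|C /andP[/rcosetsP[x _ ->] neq]].
    case: repr_rcosetP => h Hh.
    rewrite gcoefZ gcoef_regular invMg mulgA mulgV mul1g semi // gcoef_gvec groupV Hh.
    by rewrite mulrAC chi_unit ?mul1r.
  rewrite gcoefZ gcoef_regular gcoef_gvec; case: ifP; rewrite ?mulr0 //.
  move=> Hgr; case/eqP: neq; apply/rcoset_eqP; rewrite rcoset_sym mem_rcoset.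
  case: repr_rcosetP Hgr => h Hh; rewrite invMg mulgA => Hg.
  by rewrite groupMr ?groupV in Hg.
apply: summx_sub => C _; apply: scalemx_sub.
by apply: mxmodule_trans (cyclic_mx_id _ _); rewrite ?cyclic_mx_module ?in_SymG.
Qed.

Definition induced_repr := submod_repr (cyclic_mx_module reg e).

(* Frobenius reciprocity. *)
Lemma endo_image_semi (f : 'M[F]_(\rank U)) :
  centgmx induced_repr f ->
  exists v : FG, [/\ in_submod U e *m f = in_submod U v, (v <= U)%MS &
    forall h g, h \in H -> gcoef v (g * h)%g = chi h * gcoef v g].
Proof.
move=> /centgmxP; rewrite /= => cf; exists (val_submod (in_submod U e *m f)).
split; [by rewrite val_submodK | exact: val_submodP | move=> h g Hh].
(* Since [e] is also equivariant on the right and [f] commutes with right translations, the image of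
   [e] inherits this equivariance. *)
have eh : e *m reg h^-1%g = chi h *: e.
  by apply: gcoefP => k; rewrite gcoefZ gcoef_regular invgK chi_elt_mulr.
have := congr1 (fun w => gcoef (val_submod (in_submod U w *m f)) g) eh.
rewrite (in_submodJ (cyclic_mx_module reg e)) ?cyclic_mx_id //.
rewrite -[in_submod _ e *m _ *m _]mulmxA -cf ?in_SymG // [in_submod _ e *m (_ *m _)]mulmxA.
rewrite val_submodJ ?in_SymG // gcoef_regular invgK => ->.
by rewrite linearZ -scalemxAl linearZ gcoefZ.
Qed.

(** Conjugation by an element of H permutes the transpositions in the sum, so equivariance on the
    left survives. *)
Lemma swap_op_stable (A B : {set 'I_n}) : (forall h x, h \in H -> (h x \in A) = (x \in A)) ->
  (forall h x, h \in H -> (h x \in B) = (x \in B)) -> (U *m swap_op A B <= U)%MS.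
Proof.
move=> HA HB; apply/row_subP => i; rewrite row_mul; set v := row i U.
have /mem_induced semi : (v <= U)%MS by apply: row_sub.
apply/mem_induced => h g Hh; rewrite !gcoef_swap mulr_sumr.
rewrite (reindex_inj (@perm_inj _ h^-1%g)) /=; apply: eq_big => x.
  by rewrite HA ?groupV.
move=> _; rewrite mulr_sumr (reindex_inj (@perm_inj _ h^-1%g)) /=; apply: eq_big => y.
  by rewrite HB ?groupV.
move=> _; rewrite -semi //; congr gcoef.
by rewrite -tpermJ conjgE invgK -!mulgA mulKg.
Qed.

End Induced.
End GroupAlgebra.

(** * Two blocks with the same character *)

Section SwapCounting.
Variables (F : fieldType) (T : finType) (A B : {set T}).
Hypothesis disjAB : [disjoint A & B].

Lemma sum_const_nat (C : {set T}) (c : F) : \sum_(x in C) c = #|C|%:R * c.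
Proof. by rewrite sumr_const mulr_natl. Qed.

Lemma sum_eq_indicator (C : {set T}) q : \sum_(x in C) (x == q)%:R = (q \in C)%:R :> F.
Proof.
case: (boolP (q \in C)) => Cq; last first.
  by rewrite big1 // => x Cx; case: eqP Cx Cq => // -> ->.
by rewrite (bigD1 q) //= eqxx big1 ?addr0 // => x /andP[_ /negPf->].
Qed.

(** A transposition changes membership in [B] only at x and y; this additive form lets the double
    sums be evaluated term by term. *)
Lemma swap_indicator x y q : x \in A -> y \in B ->
  (tperm x y q \in B)%:R = (q \in B)%:R + (x == q)%:R - (y == q)%:R :> F.
Proof.
move=> Ax By; have NBx : x \in B = false by apply: disjointFr Ax.
have neq : x == y = false by apply: contraFF NBx => /eqP->.
case: tpermP => [->|->|/eqP nx /eqP ny].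
- by rewrite eqxx By NBx [y == x]eq_sym neq subr0 add0r.
- by rewrite eqxx By NBx neq addr0 subrr.
- by rewrite ![_ == q]eq_sym (negPf nx) (negPf ny) addr0 subr0.
Qed.

Local Notation a := (#|A|%:R : F).
Local Notation b := (#|B|%:R : F).
Local Notation al q := ((q \in A)%:R : F).
Local Notation be q := ((q \in B)%:R : F).

Lemma indicator_compl q : q \in A :|: B -> al q = 1 - be q.
Proof.
rewrite inE; case: (boolP (q \in A)) => [Aq _|_ /= ->]; last by rewrite subrr.
by rewrite (disjointFr disjAB Aq) subr0.
Qed.

(** The constant term b does not depend on q, so the difference of two indicators is an eigenvector
    for ab - (a + b). *)
Lemma sum_swap_indicator q : q \in A :|: B ->
  \sum_(x in A) \sum_(y in B) (tperm x y q \in B)%:R = b + (a * b - a - b) * be q :> F.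
Proof.
move=> /indicator_compl alq.
transitivity (\sum_(x in A) (b * be q + b * (x == q)%:R - be q) : F).
  apply: eq_bigr => x Ax; rewrite (eq_bigr _ (fun y By => swap_indicator q Ax By)).
  rewrite sumrB big_split /= !sum_const_nat sum_eq_indicator; ring.
rewrite sumrB big_split /= !sum_const_nat -mulr_sumr sum_eq_indicator alq.
ring.
Qed.

(** The linear remainder (b - 1)(be q + be r) cancels in a product of two differences of indicators
    at four distinct points, leaving the eigenvalue ab - 2(a + b) + 2. *)
Lemma sum_swap_indicator2 q r : q \in A :|: B -> r \in A :|: B -> q != r ->
  \sum_(x in A) \sum_(y in B) (tperm x y q \in B)%:R * (tperm x y r \in B)%:R =
  (a * b - (a + b) *+ 2 + 2) * (be q * be r) + (b - 1) * (be q + be r) :> F.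
Proof.
move=> /indicator_compl alq /indicator_compl alr neq.
have eq2 (x : T) : (x == q)%:R * (x == r)%:R = 0 :> F.
  by case: eqP => [->|_]; rewrite ?(negPf neq) ?mulr0 ?mul0r.
transitivity (\sum_(x in A) (b * (be q * be r)
    + (b * be q - be q) * (x == r)%:R + (b * be r - be r) * (x == q)%:R
    - be q * be r *+ 2) : F).
  apply: eq_bigr => x Ax.
  transitivity (\sum_(y in B) (((be q + (x == q)%:R) * (be r + (x == r)%:R)) +
     (- (be r + (x == r)%:R) * (y == q)%:R - (be q + (x == q)%:R) * (y == r)%:R)) : F).
    apply: eq_bigr => y By; rewrite !swap_indicator //.
    (* No y equals both q and r, so the product of the two indicators vanishes and may be added to
       the right-hand side. *)
    have := eq2 y; set yq := (y == q)%:R; set yr := (y == r)%:R => e2.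
    by rewrite -[RHS]addr0 -e2; ring.
  rewrite big_split /= sumrB -!mulr_sumr !sum_eq_indicator sum_const_nat.
  have := eq2 x; set xq := (x == q)%:R; set xr := (x == r)%:R => e2.
  by rewrite -[RHS]addr0 -(mulr0 b) -e2; ring.
rewrite sumrB !big_split /= -!mulr_sumr !sum_eq_indicator !sum_const_nat alq alr.
ring.
Qed.

End SwapCounting.

Section EqualSigns.
Variables (F : fieldType) (n : nat) (A B : {set 'I_n}).
Variables (H L : {group 'S_n}) (chi : 'S_n -> F) (eps : F).
Hypothesis disjAB : [disjoint A & B].
Hypothesis chi1 : chi 1%g = 1.
(* L is the stabiliser obtained by merging the blocks A and B of H. *)
Hypothesis chiM : {in L &, forall h k, chi (h * k)%g = chi h * chi k}.
Hypothesis sHL : H \subset L.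
Hypothesis HA : forall h x, h \in H -> (h x \in A) = (x \in A).
Hypothesis HB : forall h x, h \in H -> (h x \in B) = (x \in B).
Hypothesis LAB : forall h x, h \in L -> (h x \in A :|: B) = (x \in A :|: B).
Hypothesis swapL : forall x y, x \in A -> y \in B -> tperm x y \in L.
Hypothesis chi_swap : forall x y, x \in A -> y \in B -> chi (tperm x y) = eps.
Hypothesis eps_nz : eps != 0.

Local Notation FG := ('rV[F]_#|SymG n|).
Local Notation U := (cyclic_mx (regular_repr F (SymG n)) (chi_elt H chi)).
Local Notation a := (#|A|%:R : F).
Local Notation b := (#|B|%:R : F).

Let chiMH : {in H &, forall h k, chi (h * k)%g = chi h * chi k}.
Proof. by move=> h k Hh Hk; rewrite chiM ?(subsetP sHL). Qed.

(** Twisting by [chi], which is multiplicative on all of L, reduces the action of z to the untwisted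
    action on functions on H\L, up to the scalar [eps]. *)
Definition merged_vec (phi : 'S_n -> F) : FG :=
  gvec (fun g => if g \in L then chi g * phi g else 0).

Lemma merged_vec_mem phi : (forall h g, h \in H -> phi (h * g)%g = phi g) ->
  (merged_vec phi <= U)%MS.
Proof.
move=> phiH; apply/mem_induced => // h g Hh; rewrite !gcoef_gvec.
have Lh := subsetP sHL h Hh; rewrite groupMl //; case: ifP => Lg; last by rewrite mulr0.
by rewrite chiM // phiH // mulrA.
Qed.

Lemma merged_vec_swap phi mu :
  (forall g, g \in L ->
     \sum_(x in A) \sum_(y in B) phi (tperm x y * g)%g = mu * phi g) ->
  merged_vec phi *m swap_op F A B = (eps * mu) *: merged_vec phi.
Proof.
move=> ev; apply: gcoefP => g; rewrite gcoefZ gcoef_swap.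
case: (boolP (g \in L)) => Lg; last first.
  rewrite big1 => [|x Ax]; first by rewrite gcoef_gvec (negPf Lg) mulr0.
  by rewrite big1 // => y By; rewrite gcoef_gvec groupMl ?swapL // (negPf Lg).
transitivity (eps * chi g * \sum_(x in A) \sum_(y in B) phi (tperm x y * g)%g).
  rewrite mulr_sumr; apply: eq_bigr => x Ax; rewrite mulr_sumr; apply: eq_bigr => y By.
  by rewrite gcoef_gvec groupMl ?swapL // Lg chiM ?swapL // chi_swap.
rewrite ev // gcoef_gvec Lg; ring.
Qed.

(** The coset Hg determines the set g(B), a vertex of the Johnson scheme when g is in L; this is the
    indicator of z in g(B). *)
Definition indB (z : 'I_n) (g : 'S_n) : F := (g^-1%g z \in B)%:R.

Lemma indB_H z h g : h \in H -> indB z (h * g)%g = indB z g.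
Proof. by move=> Hh; rewrite /indB invMg permM HB ?groupV. Qed.

Lemma indB_swap z x y g : indB z (tperm x y * g)%g = (tperm x y (g^-1%g z) \in B)%:R.
Proof. by rewrite /indB invMg permM tpermV. Qed.

Lemma merged_vec_neq0 phi : phi 1%g != 0 -> merged_vec phi != 0.
Proof.
move=> nz; apply/eqP => /(congr1 (fun v => gcoef v 1%g)); rewrite gcoef0 gcoef_gvec.
by rewrite group1 chi1 mul1r; apply/eqP.
Qed.

Lemma indB1_in z : z \in B -> indB z 1%g = 1.
Proof. by rewrite /indB invg1 perm1 => ->. Qed.

Lemma indB1_notin z : z \in A -> indB z 1%g = 0.
Proof. by rewrite /indB invg1 perm1 => Az; rewrite (disjointFr disjAB Az). Qed.

(* For m = #|A| + #|B|, the eigenvalues of the Johnson scheme J(m, #|B|) used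
   here are ab, ab - m and ab - 2m + 2 (up to the sign eps); the eigenvectors are
   products of differences of indicators. *)
Lemma equal_signs_indecomposable :
  mx_indecomposable (induced_repr H chi) -> (0 < #|A|)%N -> (0 < #|B|)%N ->
  (2 : F) != 0 -> a + b = 0 /\ (#|A| = 1%N \/ #|B| = 1%N).
Proof.
move=> indec A0 B0 nz2.
have Lq g z : g \in L -> z \in A :|: B -> g^-1%g z \in A :|: B.
  by move=> Lg ABz; rewrite LAB ?groupV.
have ev0 : merged_vec (fun=> 1) *m swap_op F A B = (eps * (a * b)) *: merged_vec (fun=> 1).
  by apply: merged_vec_swap => g Lg; rewrite !sum_const_nat !mulr1.
have stab : (U *m swap_op F A B <= U)%MS by apply: swap_op_stable.
have mem0 : (merged_vec (fun=> 1) <= U)%MS by apply: merged_vec_mem.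
have nz0 : merged_vec (fun=> 1) != 0 by apply: merged_vec_neq0; apply: oner_neq0.
(* The constant function has eigenvalue ab, so by indecomposability every other eigenvector of this
   kind must have eigenvalue ab too. *)
have key (phi : 'S_n -> F) mu : (forall h g, h \in H -> phi (h * g)%g = phi g) ->
    phi 1%g != 0 -> (forall g, g \in L ->
     \sum_(x in A) \sum_(y in B) phi (tperm x y * g)%g = mu * phi g) -> mu = a * b.
  move=> phiH phi1 ev; apply/eqP; case: (eqVneq mu (a * b)) => // neq.
  have Umod := cyclic_mx_module (regular_repr F (SymG n)) (chi_elt H chi).
  case: (not_indecomposable_submod (Umod := Umod) (@swap_op_regular F n A B)
     stab mem0 (merged_vec_mem phiH) nz0 (merged_vec_neq0 phi1) ev0 (merged_vec_swap ev) _ indec).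
  by rewrite (inj_eq (mulfI eps_nz)) eq_sym.
have [x1 Ax1] : exists x, x \in A by apply/set0Pn; rewrite -card_gt0.
have [y1 By1] : exists y, y \in B by apply/set0Pn; rewrite -card_gt0.
have ABA x : x \in A -> x \in A :|: B by rewrite inE => ->.
have ABB y : y \in B -> y \in A :|: B by rewrite inE orbC => ->.
have ab0 : a + b = 0.
  have : a * b - (a + b) = a * b.
    apply: (key (fun g => indB y1 g - indB x1 g)).
    - by move=> h g Hh; rewrite !indB_H.
    - by rewrite (indB1_in By1) (indB1_notin Ax1) subr0 oner_neq0.
    - move=> g Lg.
      under eq_bigr => x _ do under eq_bigr => y _ do rewrite !indB_swap.
      under eq_bigr => x _ do rewrite sumrB.
      by rewrite sumrB !sum_swap_indicator ?Lq ?(ABA x1) ?(ABB y1) // /indB; ring.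
  by move/eqP; rewrite -subr_eq0 addrAC subrr add0r oppr_eq0 => /eqP.
split=> //; case: (ltnP 1 #|A|) => A1; last by left; apply/eqP; rewrite eqn_leq A1.
case: (ltnP 1 #|B|) => B1; last by right; apply/eqP; rewrite eqn_leq B1.
have [x2] : exists x, x \in A :\ x1.
  by apply/set0Pn; rewrite -card_gt0; move: A1; rewrite (cardsD1 x1) Ax1.
rewrite !inE => /andP[neqx Ax2].
have [y2] : exists y, y \in B :\ y1.
  by apply/set0Pn; rewrite -card_gt0; move: B1; rewrite (cardsD1 y1) By1.
rewrite !inE => /andP[neqy By2].
have neqxy x y : x \in A -> y \in B -> y != x.
  by move=> Ax By; apply: contraTneq By => ->; rewrite (disjointFr disjAB Ax).
have y1x2 := neqxy _ _ Ax2 By1; have := neqxy _ _ Ax1 By2; rewrite eq_sym => x1y2.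
rewrite eq_sym in neqx; rewrite eq_sym in neqy.
(* With two points in each block the third eigenvalue occurs; together with a + b = 0 it would give
   2 = 0. *)
have : a * b - (a + b) *+ 2 + 2 = a * b.
  apply: (key (fun g => (indB y1 g - indB x1 g) * (indB y2 g - indB x2 g))).
  - by move=> h g Hh; rewrite !indB_H.
  - by rewrite (indB1_in By1) (indB1_in By2) (indB1_notin Ax1) (indB1_notin Ax2)
       !subr0 mulr1 oner_neq0.
  move=> g Lg.
  under eq_bigr => x _ do under eq_bigr => y _
    do rewrite !indB_swap mulrBl !mulrBr.
  under eq_bigr => x _ do rewrite !sumrB.
  rewrite !sumrB !sum_swap_indicator2 ?Lq ?(ABA x1) ?(ABB y1) ?(ABA x2) ?(ABB y2)
    ?(inj_eq (@perm_inj _ _)) //.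
  by rewrite /indB; ring.
rewrite ab0 mul0rn subr0 => /eqP; rewrite -subr_eq0 addrAC subrr add0r.
by rewrite (negPf nz2).
Qed.

End EqualSigns.

(** * A trivial and a signed block *)

Section OffDiagonalSums.
Variables (F : fieldType) (T : finType) (B : {set T}).

Lemma sum_offdiag (c : T -> F) :
  \sum_(y in B) \sum_(z in B | z != y) c z = (#|B|%:R - 1) * \sum_(y in B) c y.
Proof.
transitivity (\sum_(y in B) (\sum_(z in B) c z - c y)).
  by apply: eq_bigr => y By; rewrite [in RHS](bigD1 y) //= addrAC subrr add0r.
by rewrite sumrB sum_const_nat mulrBl mul1r.
Qed.

Lemma sum_offdiag_sym (c : T -> T -> F) :
  \sum_(y in B) \sum_(z in B | z != y) c y z = \sum_(y in B) \sum_(z in B | z != y) c z y.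
Proof.
rewrite (exchange_big_dep (mem B)) /=; last by move=> i j _ /andP[].
by apply: eq_bigr => y By; apply: eq_bigl => z; rewrite By eq_sym.
Qed.
End OffDiagonalSums.

Section MixedSigns.
Variables (F : fieldType) (n : nat) (A B : {set 'I_n}).
Variables (H : {group 'S_n}) (chi : 'S_n -> F).
Hypothesis nz2 : (2 : F) != 0.
Hypothesis disjAB : [disjoint A & B].
Hypothesis chi1 : chi 1%g = 1.
Hypothesis chiM : {in H &, forall h k, chi (h * k)%g = chi h * chi k}.
Hypothesis HA : forall h x, h \in H -> (h x \in A) = (x \in A).
Hypothesis HB : forall h x, h \in H -> (h x \in B) = (x \in B).
Hypothesis swapA : {in A &, forall x y, tperm x y \in H}.
Hypothesis swapB : {in B &, forall x y, tperm x y \in H}.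
Hypothesis chiA : {in A &, forall x y, chi (tperm x y) = 1}.
Hypothesis chiB : {in B &, forall x y, x != y -> chi (tperm x y) = -1}.

Local Notation FG := ('rV[F]_#|SymG n|).
Local Notation e := (chi_elt H chi).
Local Notation U := (cyclic_mx (regular_repr F (SymG n)) e).
Local Notation Z := (swap_op F A B).
Local Notation a := (#|A|%:R : F).
Local Notation b := (#|B|%:R : F).

Let stabZ : (U *m Z <= U)%MS. Proof. exact: swap_op_stable. Qed.

Lemma neqAB x y : x \in A -> y \in B -> x != y.
Proof. by move=> Ax By; apply: contraTneq By => <-; rewrite (disjointFr disjAB Ax). Qed.

(** Used when y and z lie in one block and x in the other: the product of two exchanges sharing x
    becomes a transposition in H times one exchange. *)
Lemma tperm_mul_common (x y z : 'I_n) : x != y -> x != z -> y != z ->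
  (tperm x z * tperm x y = tperm y z * tperm x z)%g.
Proof.
move=> xy xz yz.
have -> : tperm y z = (tperm x y ^ tperm x z)%g.
  by rewrite tpermJ tpermL tpermD 1?tpermC // eq_sym.
by rewrite conjgE tpermV -!mulgA tperm2 mulg1.
Qed.

(** With x, z in [A] and y, t in [B], the two ways of matching these points differ by (x z)(y t), an
    element of H on which [chi] is -1. *)
Lemma tperm_mul_square (x y z t : 'I_n) : uniq [:: x; y; z; t] ->
  (tperm z t * tperm x y = tperm x z * tperm y t * (tperm z y * tperm x t))%g.
Proof.
rewrite /= !inE !negb_or !andbT => /and3P[/and3P[xy xz xt] /andP[yz yt] zt].
have sym (p q : 'I_n) : p != q -> (p == q = false) * (q == p = false).
  by move=> /negPf pq; split; rewrite // eq_sym.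
have E := (eqxx, sym _ _ xy, sym _ _ xz, sym _ _ xt, sym _ _ yz, sym _ _ yt, sym _ _ zt).
apply/permP => i; rewrite !permM !permE /=.
have [ix|/negPf ix] := eqVneq i x; first by rewrite ?ix !E.
have [iy|/negPf iy] := eqVneq i y; first by rewrite ?iy !E.
have [iz|/negPf iz] := eqVneq i z; first by rewrite ?iz !E.
have [it|/negPf it] := eqVneq i t; first by rewrite ?it !E.
by rewrite !(ix, iy, iz, it).
Qed.

(** Expand z^2 into products (z t)(x y) according to overlap: equal pairs give ab, pairs sharing
    only the point of [A] give (1 - b) z, pairs sharing only the point of [B] give (a - 1) z, and
    disjoint pairs cancel. *)
Lemma swap_quadratic (v : FG) : (v <= U)%MS ->
  v *m Z *m Z = (a * b) *: v + (a - b) *: (v *m Z).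
Proof.
move=> /(mem_induced chi1 chiM) semi; apply: gcoefP => g.
rewrite gcoefD !gcoefZ !gcoef_swap.
under eq_bigr => x _ do under eq_bigr => y _ do rewrite gcoef_swap.
set f := gcoef v in semi *.
pose T x y z t := f (tperm z t * (tperm x y * g))%g.
transitivity (\sum_(x in A) \sum_(y in B) (f g + \sum_(t in B | t != y) T x y x t +
  \sum_(z in A | z != x) T x y z y + \sum_(z in A | z != x) \sum_(t in B | t != y) T x y z t)).
  apply: eq_bigr => x Ax; apply: eq_bigr => y By.
  rewrite (bigD1 x) //= (bigD1 y) //= mulgA tperm2 mul1g -[RHS]addrA; congr (_ + _).
  rewrite -big_split /=; apply: eq_bigr => z /andP[Az zx].
  by rewrite (bigD1 y).
have part1 : \sum_(x in A) \sum_(y in B) \sum_(t in B | t != y) T x y x t =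
    (1 - b) * \sum_(x in A) \sum_(y in B) f (tperm x y * g)%g.
  rewrite mulr_sumr; apply: eq_bigr => x Ax.
  rewrite -opprB mulNr -sum_offdiag -sumrN; apply: eq_bigr => y By; rewrite -sumrN.
  apply: eq_bigr => t /andP[Bt ty].
  rewrite eq_sym in ty; have := tperm_mul_common (neqAB Ax By) (neqAB Ax Bt) ty.
  rewrite /T mulgA => ->.
  by rewrite -mulgA semi ?swapB // chiB // mulN1r.
have part2 : \sum_(x in A) \sum_(y in B) \sum_(z in A | z != x) T x y z y =
    (a - 1) * \sum_(x in A) \sum_(y in B) f (tperm x y * g)%g.
  rewrite exchange_big [in RHS]exchange_big /= mulr_sumr; apply: eq_bigr => y By.
  rewrite -sum_offdiag; apply: eq_bigr => x Ax; apply: eq_bigr => z /andP[Az zx].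
  rewrite /T mulgA (tpermC z y) (tpermC x y) (@tperm_mul_common y x z).
  - by rewrite -mulgA semi ?swapA // chiA // mul1r tpermC.
  - by rewrite eq_sym neqAB.
  - by rewrite eq_sym neqAB.
  - by rewrite eq_sym.
have part3 : \sum_(x in A) \sum_(y in B) \sum_(z in A | z != x) \sum_(t in B | t != y)
    T x y z t = 0.
  apply: big1 => x Ax; rewrite exchange_big /=.
  apply: big1 => z /andP[Az zx].
  set S := \sum_(y in B) _.
  (* Interchanging y and t replaces one matching of x, z with y, t by the other, which changes the
     sign. *)
  have : S = - S.
    rewrite {1}/S sum_offdiag_sym -sumrN; apply: eq_bigr => y By.
    rewrite -sumrN; apply: eq_bigr => t /andP[Bt ty].
    rewrite /T !mulgA (@tperm_mul_square x t z y); last first.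
      rewrite /= !inE !negb_or (neqAB Ax Bt) (neqAB Ax By) (neqAB Az By) ty.
      by rewrite [x == z]eq_sym zx [t == z]eq_sym (neqAB Az Bt).
    rewrite -!mulgA semi ?swapA // semi ?swapB // chiA // chiB //.
    by rewrite mul1r mulN1r.
  move/eqP; rewrite -subr_eq0 opprK -mulr2n -mulr_natl mulf_eq0 (negPf nz2) /=.
  by move/eqP.
transitivity (\sum_(x in A) \sum_(y in B) f g
  + \sum_(x in A) \sum_(y in B) \sum_(t in B | t != y) T x y x t
  + \sum_(x in A) \sum_(y in B) \sum_(z in A | z != x) T x y z y
  + \sum_(x in A) \sum_(y in B) \sum_(z in A | z != x) \sum_(t in B | t != y) T x y z t).
  by rewrite -!big_split /=; apply: eq_bigr => x _; rewrite -!big_split.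
rewrite part1 part2 part3 !sum_const_nat; ring.
Qed.

Variables (x0 y0 : 'I_n).
Hypothesis Ax0 : x0 \in A.
Hypothesis By0 : y0 \in B.

Lemma swap0_notin : tperm x0 y0 \notin H.
Proof.
by apply/negP => Ht; have := HA x0 Ht; rewrite tpermL Ax0 (disjointFl disjAB By0).
Qed.

Lemma gcoef_e_swap0 : gcoef e (tperm x0 y0) = 0.
Proof. by rewrite gcoef_gvec (negPf swap0_notin). Qed.

(** Among the exchanges (x y), only (x0 y0) itself has a product with (x0 y0) lying in H, since
    every other product moves x0 or fails to preserve [A]. As [e] vanishes at (x0 y0), e z is not a
    multiple of [e]. *)
Lemma gcoef_eZ_swap0 : gcoef (e *m Z) (tperm x0 y0) = 1.
Proof.
rewrite gcoef_swap (bigD1 x0) //= (bigD1 y0) //= tperm2 gcoef_gvec group1 chi1.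
rewrite big1 => [|y /andP[By yy]]; last first.
  rewrite gcoef_gvec; case: ifP => // Ht; have := HA x0 Ht; rewrite permM tpermL.
  rewrite tpermD ?Ax0 ?(disjointFl disjAB By) // 1?eq_sym //.
  by rewrite eq_sym neqAB.
rewrite big1 ?addr0 // => x /andP[Ax xx].
apply: big1 => y By; rewrite gcoef_gvec; case: ifP => // Ht.
have := HA x0 Ht; rewrite permM (@tpermD _ x y x0) // 1?eq_sym ?neqAB //.
by rewrite tpermL Ax0 (disjointFl disjAB By0).
Qed.

Lemma gcoef_eZ_1 : gcoef (e *m Z) 1%g = 0.
Proof.
rewrite gcoef_swap; apply: big1 => x Ax; apply: big1 => y By; rewrite mulg1 gcoef_gvec.
case: ifP => // Ht; have := HA x Ht.
by rewrite tpermL Ax (disjointFl disjAB By).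
Qed.

Lemma eZ_neq0 c : e *m Z + c *: e != 0.
Proof.
apply/eqP => /(congr1 (fun v => gcoef v (tperm x0 y0))); rewrite gcoef0 gcoefD gcoefZ.
by rewrite gcoef_e_swap0 gcoef_eZ_swap0 mulr0 addr0; apply/eqP; rewrite oner_neq0.
Qed.

Let eU : (e <= U)%MS := cyclic_mx_id _ _.

Lemma eZ_mem c : ((e *m Z + c *: e)%R <= U)%MS.
Proof.
by rewrite addmx_sub ?scalemx_sub // (submx_trans _ stabZ) // submxMr.
Qed.

(** By the quadratic relation, e(z - a) and e(z + b) are eigenvectors of z for -b and a, and these
    differ unless a + b = 0. *)
Lemma mixed_signs_indecomposable : mx_indecomposable (induced_repr H chi) -> a + b = 0.
Proof.
move=> indec; apply/eqP; case: eqVneq => // nz.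
have Umod := cyclic_mx_module (regular_repr F (SymG n)) e.
case: (@not_indecomposable_submod _ _ _ _ _ _ _ Umod _ _ (- b) a (@swap_op_regular F n A B)
     stabZ (eZ_mem (- a)) (eZ_mem b) (eZ_neq0 _) (eZ_neq0 _) _ _ _ indec).
- rewrite mulmxDl swap_quadratic // -scalemxAl; apply: gcoefP => g.
  by rewrite !(gcoefD, gcoefZ); ring.
- rewrite mulmxDl swap_quadratic // -scalemxAl; apply: gcoefP => g.
  by rewrite !(gcoefD, gcoefZ); ring.
- by rewrite eq_sym -subr_eq0 opprK.
Qed.

(** * The endomorphism ring when H has exactly two blocks *)

Section TwoBlocks.
Hypothesis HP : forall s : 'S_n, (forall y, y \in B -> s y \in B) -> s \in H.
Hypothesis AB : forall x, x \notin B -> x \in A.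

(** The double coset of g depends on how many points of [B] leave [B]. If none does, g is in H; if
    one does, g is in the double coset of (x0 y0); if two do, moving a transposition across g
    compares opposite signs and f(g) = 0. *)
Lemma bisemi_eq0 (f : 'S_n -> F) :
  (forall h g, h \in H -> f (h * g)%g = chi h * f g) ->
  (forall h g, h \in H -> f (g * h)%g = chi h * f g) ->
  f 1%g = 0 -> f (tperm x0 y0) = 0 -> forall g, f g = 0.
Proof.
move=> fl fr f1 ft g.
have chi_nz h : h \in H -> chi h != 0.
  by move=> Hh; apply/eqP => h0; have /eqP := chi_unit chi1 chiM Hh;
    rewrite h0 mul0r eq_sym oner_eq0.
have fl0 h k : h \in H -> f (h * k)%g = 0 -> f k = 0.
  by move=> Hh /eqP; rewrite fl // mulf_eq0 (negPf (chi_nz _ Hh)) => /eqP.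
have fr0 h k : h \in H -> f (k * h)%g = 0 -> f k = 0.
  by move=> Hh /eqP; rewrite fr // mulf_eq0 (negPf (chi_nz _ Hh)) => /eqP.
case: (boolP [forall y in B, g y \in B]) => [/forall_inP gB|].
  by rewrite -[g]mulg1 fl ?HP // f1 mulr0.
rewrite negb_forall => /existsP[y]; rewrite negb_imply => /andP[By /AB Agy].
(* Reduce to g y0 = x0 and g x0 \in B. *)
apply: (fl0 (tperm y0 y)); first exact: swapB.
apply: (fr0 (tperm (g y) x0)); first exact: swapA.
set g1 := (_ * _ * _)%g.
have g1y : g1 y0 = x0 by rewrite !permM tpermL tpermL.
(* Otherwise [g1] would permute [A], although x0 is the image of y0, which lies outside [A]. *)
have [x Ax Bg1x] : exists2 x, x \in A & g1 x \in B.
  apply/exists_inP; have [//|/exists_inPn none] := boolP [exists x in A, g1 x \in B].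
  have sub : [set g1 x | x in A] \subset A.
    apply/subsetP => _ /imsetP[x Ax ->]; apply: AB; exact: none.
  have /eqP imA : [set g1 x | x in A] == A.
    by rewrite eqEcard sub (card_imset _ (@perm_inj _ g1)) leqnn.
  have := Ax0; rewrite -{1}imA -g1y mem_imset; last exact: perm_inj.
  by rewrite (disjointFl disjAB By0).
apply: (fl0 (tperm x0 x)); first exact: swapA.
set g2 := (_ * g1)%g.
have g2x : g2 x0 \in B by rewrite permM tpermL.
have g2y : g2 y0 = x0 by rewrite permM tpermD ?neqAB.
case: (boolP [forall t in B, (t != y0) ==> (g2 t \in B)]) => [/forall_inP g2B|].
  rewrite -[g2](mulKg (tperm x0 y0)) tpermV fr ?ft ?mulr0 //.
  apply: HP => t Bt; rewrite permM.
  have [->|ty] := eqVneq t y0; first by rewrite tpermR.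
  by rewrite tpermD 1?eq_sym ?(implyP (g2B t Bt)) // eq_sym neqAB.
rewrite negb_forall => /existsP[t]; rewrite !negb_imply => /and3P[Bt ty /AB Ag2t].
(* On the left the transposition lies in [B] and contributes -1; on the right its conjugate lies in
   [A] and contributes 1. Hence 2 f(g2) = 0. *)
have : f (tperm y0 t * g2)%g = f (g2 * tperm (g2 y0) (g2 t))%g.
  by rewrite -tpermJ conjgE mulKVg.
have Hyt : tperm y0 t \in H by apply: swapB.
have Hxt : tperm (g2 y0) (g2 t) \in H by rewrite g2y; apply: swapA.
rewrite (fl _ _ Hyt) (fr _ _ Hxt) g2y; rewrite eq_sym in ty.
rewrite (chiB By0 Bt ty) (chiA Ax0 Ag2t) mul1r mulN1r => /eqP.
rewrite eq_sym -subr_eq0 opprK -mulr2n -mulr_natl mulf_eq0 (negPf nz2) /=.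
by move/eqP.
Qed.

Lemma mixed_signs_End : a + b = 0 -> End_iso_dual (induced_repr H chi).
Proof.
move=> ab0.
(* As a = -b, the relation (z - a)(z + b) = 0 says that z + b squares to zero. *)
pose Z' := Z + b%:M.
have cZ' x : x \in SymG n -> Z' *m regular_repr F (SymG n) x = regular_repr F (SymG n) x *m Z'.
  by move=> Gx; rewrite mulmxDl mulmxDr swap_op_regular // scalar_mxC.
have stab' : (U *m Z' <= U)%MS.
  by rewrite mulmxDr mul_mx_scalar addmx_sub ?scalemx_sub.
have eZ' : e *m Z' = e *m Z + b *: e by rewrite mulmxDr mul_mx_scalar.
have eZ'U : (e *m Z' <= U)%MS by rewrite eZ' eZ_mem.
have cN := restr_submod_centg (cyclic_mx_module _ _) cZ' stab'.
set N := restr_submod U Z' in cN.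
have eN : in_submod U e *m N = in_submod U (e *m Z') by apply: restr_submodE.
exists N; split=> //.
- apply/eqP => N0; move: eN; rewrite N0 mulmx0 => /esym/(congr1 val_submod).
  by rewrite in_submodK // linear0 eZ' => /eqP; rewrite (negPf (eZ_neq0 _)).
- apply: (cyclic_endo_eq (rG := regular_repr F (SymG n))).
  + apply/centgmxP => x Gx; have cNx := centgmxP cN x Gx.
    by rewrite -[N *m N *m _]mulmxA cNx [N *m (_ *m N)]mulmxA cNx -[LHS]mulmxA.
  + by apply/centgmxP => x Gx; rewrite mul0mx mulmx0.
  rewrite mulmxA eN restr_submodE // mulmx0 (_ : e *m Z' *m Z' = 0) ?linear0 //.
  rewrite eZ' mulmxDr mulmxDl swap_quadratic // mul_mx_scalar -scalemxAl.
  have -> : a = - b by apply/eqP; rewrite -addr_eq0 ab0.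
  by apply: gcoefP => g; rewrite !(gcoefD, gcoefZ) gcoef0; ring.
move=> f cf; have [v [ev vU vr]] := endo_image_semi chiM cf.
have vl := (mem_induced chi1 chiM v).1 vU.
pose c := gcoef v 1%g; pose d := gcoef v (tperm x0 y0).
(* Both sides are equivariant on both sides and agree at 1 and (x0 y0), where [e] and e z take the
   values 1, 0 and 0, 1. *)
have defv : v = c *: e + d *: (e *m Z).
  apply: gcoefP => g; apply/eqP; rewrite -subr_eq0; apply/eqP; move: g.
  apply: bisemi_eq0.
  - move=> h g Hh; rewrite vl // !gcoefD !gcoefZ chi_elt_mull //.
    have -> : gcoef (e *m Z) (h * g)%g = chi h * gcoef (e *m Z) g.
      by apply: (mem_induced chi1 chiM _).1 => //; apply: submx_trans stabZ; apply: submxMr.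
    ring.
  - move=> h g Hh; rewrite vr // !gcoefD !gcoefZ chi_elt_mulr //.
    have -> : gcoef (e *m Z) (g * h)%g = chi h * gcoef (e *m Z) g.
      rewrite !gcoef_swap mulr_sumr; apply: eq_bigr => x _; rewrite mulr_sumr.
      by apply: eq_bigr => y _; rewrite mulgA chi_elt_mulr.
    ring.
  - rewrite gcoefD !gcoefZ gcoef_eZ_1 gcoef_gvec group1 chi1 -/c; ring.
  - rewrite gcoefD !gcoefZ gcoef_e_swap0 gcoef_eZ_swap0 -/d; ring.
(* Rewriting c + d z in terms of z + b shifts the scalar by -db. *)
exists (c - d * b), d; apply: (cyclic_endo_eq cf).
  apply/centgmxP => x Gx; rewrite mulmxDl mulmxDr scalar_mxC.
  by rewrite -scalemxAl -scalemxAr (centgmxP cN).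
have -> : in_submod U e *m f =
    (c - d * b) *: in_submod U e + d *: in_submod U (e *m Z').
  have -> : in_submod U e *m f = in_submod U ((c - d * b) *: e + d *: (e *m Z')).
    rewrite ev defv eZ'; congr (in_submod U _).
    by apply: gcoefP => g; rewrite !(gcoefD, gcoefZ); ring.
  by rewrite linearD !linearZ.
by rewrite [RHS]mulmxDr mul_mx_scalar -scalemxAr eN.
Qed.

End TwoBlocks.
End MixedSigns.

(** * Young subgroups *)

Section Blocks.
Local Open Scope nat_scope.

(** Replaces the counting definition by a recursion on the composition, as the inductions below
    require. *)
Lemma blk_cons x c i : blk (x :: c) i = if x <= i then (blk c (i - x)).+1 else 0.
Proof.
rewrite /blk /= take0 /= addn0 -[1]/(1 + 0) iotaDl count_map.
case: leqP => [le_xi|lt_ix].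
  rewrite add1n; congr (_.+1); apply: eq_count => k /=.
  by rewrite -leq_subRL // addnC.
rewrite add0n; apply/eqP; rewrite -leqn0 leqNgt -has_count; apply/hasPn => k _ /=.
by rewrite -ltnNge (leq_trans lt_ix) ?leq_addr.
Qed.

Lemma blk_lt_size c i : i < sumn c -> blk c i < size c.
Proof.
elim: c i => [|x c IHc] i //=; rewrite blk_cons; case: (leqP x i) => // le_xi lt_i.
by rewrite ltnS IHc // ltn_subLR.
Qed.

Lemma blk_cat_size al be i : (size al <= blk (al ++ be) i) = (sumn al <= i).
Proof.
elim: al i => [|x al IHal] i //=; rewrite blk_cons; case: (leqP x i) => [le_xi|lt_ix].
  by rewrite ltnS IHal leq_subRL.
by rewrite ltn0; apply/esym/negbTE; rewrite -ltnNge (leq_trans lt_ix) ?leq_addr.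
Qed.

Lemma count_blk c k : k < size c ->
  count (fun i => blk c i == k) (iota 0 (sumn c)) = nth 0 c k.
Proof.
elim: c k => [|x c IHc] k //= lt_k; rewrite iotaD add0n count_cat.
have -> : iota x (sumn c) = map (addn x) (iota 0 (sumn c)) by rewrite -iotaDl addn0.
rewrite count_map.
have -> : count (fun i => blk (x :: c) i == k) (iota 0 x) = (k == 0) * x.
  have [->|k0] := eqVneq k 0.
    rewrite mul1n -[RHS](size_iota 0) -count_predT; apply: eq_in_count => i.
    by rewrite mem_iota /= add0n blk_cons => lt_ix; rewrite leqNgt lt_ix.
  rewrite mul0n -[RHS](count_pred0 (iota 0 x)); apply: eq_in_count => i.
  rewrite mem_iota /= add0n blk_cons => lt_ix; rewrite leqNgt lt_ix /=.
  by rewrite eq_sym (negPf k0).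
have -> : count (preim (addn x) (fun i => blk (x :: c) i == k)) (iota 0 (sumn c)) =
   count (fun i => (blk c i).+1 == k) (iota 0 (sumn c)).
  by apply: eq_count => i /=; rewrite blk_cons leq_addr addKn.
case: k lt_k => [|k] lt_k /=; first by rewrite mul1n (@eq_count _ _ pred0) ?count_pred0 ?addn0.
by rewrite mul0n add0n -IHc //; apply: eq_count => i.
Qed.

Lemma card_blk n c k : sumn c = n -> k < size c ->
  #|[set i : 'I_n | blk c i == k]| = nth 0 c k.
Proof.
move=> sum_c lt_k; rewrite -(count_blk lt_k) sum_c cardsE -sum1_card.
rewrite -(big_mkord (fun i => blk c i == k) (fun=> 1)) sum1_count.
by rewrite /index_iota subn0.
Qed.
End Blocks.

Section ColourGroup.
Variables (n : nat).

(** With Young subgroups as stabilisers of colourings, merging two blocks is just identifying two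
    colours. *)
Definition colour_set (kap : 'I_n -> nat) : {set 'S_n} :=
  [set s : 'S_n | [forall i, kap (s i) == kap i]].

Lemma colour_setP kap (s : 'S_n) : reflect (forall i, kap (s i) = kap i) (s \in colour_set kap).
Proof. by rewrite inE; apply: (iffP forallP) => H i; apply/eqP; apply: H. Qed.

Lemma colour_group_set kap : group_set (colour_set kap).
Proof.
apply/group_setP; split; first by apply/colour_setP => i; rewrite perm1.
by move=> s t /colour_setP Hs /colour_setP Ht; apply/colour_setP => i; rewrite permM Ht Hs.
Qed.
Definition colour_group kap : {group 'S_n} := Group (colour_group_set kap).

Lemma colour_groupP kap (s : 'S_n) : reflect (forall i, kap (s i) = kap i) (s \in colour_group kap).
Proof. exact: colour_setP. Qed.

Lemma tperm_colour kap x y : kap x = kap y -> tperm x y \in colour_group kap.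
Proof. by move=> kxy; apply/colour_groupP => i; case: tpermP => [->|->|]. Qed.

End ColourGroup.

Section PartialSign.
Variables (F : fieldType) (n : nat) (S : {set 'I_n}).

(** The sign of the action on [S] alone; it is multiplicative on subgroups stabilising [S]. *)
Definition psign (s : 'S_n) : F := (-1) ^+ odd_perm (restr_perm S s).

Lemma stab_astabs (s : 'S_n) : (forall x, (s x \in S) = (x \in S)) -> s \in 'N(S | 'P)%g.
Proof. by move=> sS; apply/astabsP => x; rewrite /= apermE sS. Qed.

Lemma psign1 : psign 1%g = 1.
Proof. by rewrite /psign morph1 odd_perm1. Qed.

Lemma psignM (H : {group 'S_n}) : (forall h x, h \in H -> (h x \in S) = (x \in S)) ->
  {in H &, forall h k, psign (h * k)%g = psign h * psign k}.
Proof.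
move=> HS h k Hh Hk; rewrite /psign morphM ?stab_astabs //; last 2 first.
- by move=> x; apply: HS.
- by move=> x; apply: HS.
by rewrite odd_permM signr_addb.
Qed.

Lemma psign_tperm_in x y : x \in S -> y \in S -> x != y -> psign (tperm x y) = -1.
Proof.
move=> Sx Sy xy; rewrite /psign (_ : restr_perm S _ = tperm x y) ?odd_tperm ?xy //.
have st : tperm x y \in 'N(S | 'P)%g.
  by apply: stab_astabs => z; case: tpermP => [->|->|]; rewrite ?Sx ?Sy.
apply/permP => z; case: (boolP (z \in S)) => Sz; first by rewrite restr_permE.
rewrite (out_perm (restr_perm_on _ _) Sz) tpermD //.
  by apply: contraNneq Sz => <-.
by apply: contraNneq Sz => <-.
Qed.

Lemma psign_tperm_notin x y : x \notin S -> y \notin S -> psign (tperm x y) = 1.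
Proof.
move=> Sx Sy; rewrite /psign (_ : restr_perm S _ = 1%g) ?odd_perm1 //.
have st : tperm x y \in 'N(S | 'P)%g.
  by apply: stab_astabs => z; case: tpermP => [->|->|]; rewrite ?(negPf Sx) ?(negPf Sy).
apply/permP => z; rewrite perm1; case: (boolP (z \in S)) => Sz.
  by rewrite restr_permE // tpermD //; apply: contraTneq Sz => <-.
by rewrite (out_perm (restr_perm_on _ _) Sz).
Qed.

End PartialSign.

(** * The signed Young module as an induced module *)

Section SignedYoungModule.
Variables (F : fieldType) (n : nat) (alpha beta : seq nat).
Hypothesis size_ab : (sumn alpha + sumn beta)%N = n.

Local Notation c := (alpha ++ beta).
Let kap (i : 'I_n) : nat := blk c i.
Let S : {set 'I_n} := [set i : 'I_n | sumn alpha <= i]%N.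
Let H := colour_group kap.
Let chi := @psign F n S.
Let Blk k := [set i : 'I_n | kap i == k].

Lemma in_signed i : (i \in S) = (size alpha <= kap i)%N.
Proof. by rewrite inE blk_cat_size. Qed.

Lemma in_Blk k i : (i \in Blk k) = (kap i == k).
Proof. by rewrite inE. Qed.

Lemma young_signed (h : 'S_n) x : h \in H -> (h x \in S) = (x \in S).
Proof. by move=> /colour_groupP Hh; rewrite !in_signed Hh. Qed.

Lemma young_Blk k (h : 'S_n) x : h \in H -> (h x \in Blk k) = (x \in Blk k).
Proof. by move=> /colour_groupP Hh; rewrite !inE Hh. Qed.

Let chi1 : chi 1%g = 1 := psign1 F S.
Let chiM : {in H &, forall h k, chi (h * k)%g = chi h * chi k}.
Proof. exact: psignM young_signed. Qed.

Lemma YoungAP (s : 'S_n) :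
  reflect (s \in H /\ forall i, i \in S -> s i = i) (s \in YoungA n alpha beta).
Proof.
rewrite [s \in YoungA _ _ _]inE; apply: (iffP forallP) => [Hs|[/colour_groupP Hs fixS] i].
  split; first by apply/colour_groupP => i; have /andP[/eqP] := Hs i.
  by move=> i; rewrite inE => le_i; have /andP[_ /implyP/(_ le_i)/eqP] := Hs i.
by rewrite -/(kap _) Hs eqxx /=; apply/implyP => le_i; rewrite fixS ?inE.
Qed.

Lemma YoungBP (s : 'S_n) :
  reflect (s \in H /\ forall i, i \notin S -> s i = i) (s \in YoungB n alpha beta).
Proof.
rewrite [s \in YoungB _ _ _]inE; apply: (iffP forallP) => [Hs|[/colour_groupP Hs fixS] i].
  split; first by apply/colour_groupP => i; have /andP[/eqP] := Hs i.
  by move=> i; rewrite inE -ltnNge => le_i; have /andP[_ /implyP/(_ le_i)/eqP] := Hs i.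
by rewrite -/(kap _) Hs eqxx /=; apply/implyP => le_i; rewrite fixS ?inE -?ltnNge.
Qed.

(** Each g in H is uniquely a product x y with x in [YoungA] and y in [YoungB]: y is the restriction
    of g to the signed points and x = g y^-1. *)
Lemma young_eltE : young_elt F n alpha beta = chi_elt H chi.
Proof.
apply: gcoefP => g; rewrite gcoef_gvec /young_elt gcoef_sum.
under eq_bigr => x _.
  rewrite gcoef_sum; under eq_bigr => y _ do rewrite gcoefZ gcoef_gelt.
  over.
have restrM x y : x \in YoungA n alpha beta -> y \in YoungB n alpha beta ->
    (x * y)%g \in H /\ restr_perm S (x * y)%g = y.
  move=> /YoungAP[Hx xS] /YoungBP[Hy yS]; have Hxy := groupM Hx Hy; split=> //.
  have nS : (x * y)%g \in 'N(S | 'P)%g by apply: stab_astabs => z; apply: young_signed.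
  apply/permP => z; case: (boolP (z \in S)) => Sz.
    by rewrite restr_permE // permM xS.
  by rewrite (out_perm (restr_perm_on _ _) Sz) yS.
case: ifP => Hg; last first.
  apply: big1 => x Yx; apply: big1 => y Yy; case: eqP => [xy|]; last by rewrite mulr0.
  by have [] := restrM x y Yx Yy; rewrite xy Hg.
have nS : g \in 'N(S | 'P)%g by apply: stab_astabs => z; apply: young_signed.
pose yg := restr_perm S g; pose xg := (g * yg^-1)%g.
have ygE z : z \in S -> yg z = g z by move=> Sz; apply: restr_permE.
have ygN z : z \notin S -> yg z = z by apply: (out_perm (restr_perm_on _ _)).
have Yyg : yg \in YoungB n alpha beta.
  apply/YoungBP; split=> //; apply/colour_groupP => z.
  by case: (boolP (z \in S)) => Sz; [rewrite ygE // (colour_groupP _ _ Hg) | rewrite ygN].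
have Yxg : xg \in YoungA n alpha beta.
  apply/YoungAP; split; first by rewrite groupM ?groupV //; case/YoungBP: Yyg.
  by move=> z Sz; rewrite permM -ygE // permK.
rewrite (bigD1 xg) //= (bigD1 yg) //= {1}/xg mulgKV eqxx mulr1.
rewrite big1 => [|y /andP[Yy neq]]; last first.
  case: eqP => [xy|]; last by rewrite mulr0.
  by have [_] := restrM xg y Yxg Yy; rewrite xy => def; rewrite -def eqxx in neq.
rewrite big1 ?addr0 // => x /andP[Yx neq].
apply: big1 => y Yy; case: eqP => [xy|]; last by rewrite mulr0.
have [_] := restrM x y Yx Yy; rewrite xy => def.
by case/eqP: neq; rewrite /xg /yg def -xy mulgK.
Qed.

(** The dimension of [Mrep] depends on its generator, so properties are transported through a
    predicate that ranges over all dimensions. *)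
Lemma MrepE (P : forall d, mx_representation F (SymG n) d -> Prop) :
  P _ (induced_repr H chi) <-> P _ (Mrep F n alpha beta).
Proof. by rewrite /Mrep young_eltE. Qed.

Lemma card_Blk k : (k < size c)%N -> #|Blk k| = nth 0%N c k.
Proof. by move=> lt_k; apply: card_blk; rewrite // sumn_cat. Qed.

Lemma disj_Blk j k : j != k -> [disjoint Blk j & Blk k].
Proof.
move=> neq; rewrite -setI_eq0; apply/eqP/setP => i; rewrite !inE.
by case: eqP => // ->; rewrite (negPf neq).
Qed.

Hypothesis nz2 : (2 : F) != 0.
Hypothesis c_pos : all (fun x => 0 < x)%N c.

Lemma Blk_gt0 k : (k < size c)%N -> (0 < #|Blk k|)%N.
Proof. by move=> lt_k; rewrite card_Blk //; apply: (allP c_pos); apply: mem_nth. Qed.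

Lemma same_side_pair j k : mx_indecomposable (Mrep F n alpha beta) ->
  (j < size c)%N -> (k < size c)%N -> j != k ->
  (size alpha <= j)%N = (size alpha <= k)%N ->
  (nth 0%N c j + nth 0%N c k)%:R = 0 :> F /\ (nth 0%N c j = 1%N \/ nth 0%N c k = 1%N).
Proof.
move=> /(MrepE (fun d => @mx_indecomposable F _ _ d)) indec lt_j lt_k neq side.
(* Recolouring block k as block j merges them. Both lie on the same side, so the signed points stay
   stable and [chi] extends to L. *)
pose kap' i := if kap i == k then j else kap i.
pose L := colour_group kap'.
have L_S h x : h \in L -> (h x \in S) = (x \in S).
  move=> /colour_groupP Lh; rewrite !in_signed; have := Lh x; rewrite /kap'.
  have [->|_] := eqVneq (kap (h x)) k; have [->|_] := eqVneq (kap x) k => //.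
  - by move=> <-; rewrite side.
  - by move=> ->; rewrite side.
  - by move=> ->.
pose eps : F := if (size alpha <= j)%N then -1 else 1.
rewrite natrD -!card_Blk //.
apply: (@equal_signs_indecomposable F n (Blk j) (Blk k) H L chi eps) => //.
- exact: disj_Blk.
- exact: psignM L_S.
- by apply/subsetP => h /colour_groupP Hh; apply/colour_groupP => i; rewrite /kap' Hh.
- exact: young_Blk.
- exact: young_Blk.
- move=> h x /colour_groupP/(_ x); rewrite /kap' 2!in_setU !in_Blk.
  have [->|nk] := eqVneq (kap (h x)) k; have [->|nk'] := eqVneq (kap x) k;
    rewrite ?orbT ?orbF ?eqxx //.
  + by move=> <-; rewrite eqxx.
  + by move=> ->; rewrite eqxx.
  + by move=> ->.
- move=> x y; rewrite !in_Blk => /eqP kx /eqP ky; apply: tperm_colour.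
  by rewrite /kap' ky eqxx kx (negPf neq).
- move=> x y; rewrite !in_Blk => /eqP kx /eqP ky; rewrite /chi /eps.
  have xy : x != y by apply: contraNneq neq => exy; rewrite -kx exy ky.
  case: ifP => le_j; first by rewrite psign_tperm_in // in_signed ?kx // ky -side.
  by rewrite psign_tperm_notin // in_signed ?kx ?le_j // ky -side le_j.
- by rewrite /eps; case: ifP; rewrite ?oppr_eq0 oner_eq0.
- exact: Blk_gt0.
- exact: Blk_gt0.
Qed.

Lemma mixed_pair j k : mx_indecomposable (Mrep F n alpha beta) ->
  (j < size alpha)%N -> (size alpha <= k < size c)%N ->
  (nth 0%N c j + nth 0%N c k)%:R = 0 :> F.
Proof.
move=> /(MrepE (fun d => @mx_indecomposable F _ _ d)) indec lt_j /andP[le_k lt_k].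
have lt_jc : (j < size c)%N by rewrite size_cat ltn_addr.
have neq : j != k by rewrite neq_ltn (leq_trans lt_j).
have [x Bx] : exists x, x \in Blk j by apply/set0Pn; rewrite -card_gt0 Blk_gt0.
have [y By] : exists y, y \in Blk k by apply/set0Pn; rewrite -card_gt0 Blk_gt0.
rewrite natrD -!card_Blk //.
apply: (@mixed_signs_indecomposable F n (Blk j) (Blk k) H chi) Bx By indec => //.
- exact: disj_Blk.
- exact: young_Blk.
- exact: young_Blk.
- by move=> u v; rewrite !in_Blk => /eqP ku /eqP kv; apply: tperm_colour; rewrite ku.
- by move=> u v; rewrite !in_Blk => /eqP ku /eqP kv; apply: tperm_colour; rewrite ku.
- move=> u v; rewrite !in_Blk => /eqP ku /eqP kv; apply: psign_tperm_notin;
  by rewrite in_signed ?ku ?kv -ltnNge.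
- by move=> u v; rewrite !in_Blk => /eqP ku /eqP kv; apply: psign_tperm_in; rewrite in_signed ?ku ?kv.
Qed.

(* Block j plays the trivial and block k the signed role; a one-point block
   qualifies for both. *)
Lemma two_blocks_End j k : size c = 2 -> (j < 2)%N -> (k < 2)%N -> j != k ->
  (j < size alpha)%N \/ nth 0%N c j = 1%N -> (size alpha <= k)%N \/ nth 0%N c k = 1%N ->
  n%:R = 0 :> F -> End_iso_dual (Mrep F n alpha beta).
Proof.
move=> c2 lt_j lt_k neq hj hk n0; apply/(MrepE (fun d => @End_iso_dual F _ _ d)).
have ltj : (j < size c)%N by rewrite c2.
have ltk : (k < size c)%N by rewrite c2.
have [x Bx] : exists x, x \in Blk j by apply/set0Pn; rewrite -card_gt0 Blk_gt0.
have [y By] : exists y, y \in Blk k by apply/set0Pn; rewrite -card_gt0 Blk_gt0.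
have kap2 i : kap i = j \/ kap i = k.
  have : (kap i < size c)%N by apply: blk_lt_size; rewrite sumn_cat size_ab.
  by rewrite c2; lia.
have single m : nth 0%N c m = 1%N -> (m < size c)%N -> {in Blk m &, forall u v, u = v}.
  move=> c1 ltm u v Bu Bv.
  have /card_le1_eqP le1 : (#|Blk m| <= 1)%N by rewrite card_Blk ?c1.
  exact: le1.
apply: (@mixed_signs_End F n (Blk j) (Blk k) H chi) Bx By _ _ _ => //.
- exact: disj_Blk.
- exact: young_Blk.
- exact: young_Blk.
- by move=> u v; rewrite !in_Blk => /eqP ku /eqP kv; apply: tperm_colour; rewrite ku.
- by move=> u v; rewrite !in_Blk => /eqP ku /eqP kv; apply: tperm_colour; rewrite ku.
- move=> u v Bu Bv; case: hj => [ltja|c1].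
    move: Bu Bv; rewrite !in_Blk => /eqP ku /eqP kv; apply: psign_tperm_notin;
    by rewrite in_signed ?ku ?kv -ltnNge.
  by rewrite (single j c1 ltj u v Bu Bv) tperm1.
- move=> u v Bu Bv uv; case: hk => [leka|c1].
    by move: Bu Bv; rewrite !in_Blk => /eqP ku /eqP kv; apply: psign_tperm_in; rewrite ?in_signed ?ku ?kv.
  by rewrite (single k c1 ltk u v Bu Bv) eqxx in uv.
- move=> s sB; apply/colour_groupP => i.
  (* An injective map of a finite block into itself is onto, so [s] preserves the complement as
     well. *)
  have sB' : (s i \in Blk k) = (i \in Blk k).
    have imB : [set s z | z in Blk k] = Blk k.
      apply/eqP; rewrite eqEcard (card_imset _ (@perm_inj _ s)) leqnn andbT.
      by apply/subsetP => _ /imsetP[z Bz ->]; apply: sB.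
    by rewrite -{1}imB mem_imset //; apply: perm_inj.
  move: sB'; rewrite !in_Blk.
  by case: (kap2 i) (kap2 (s i)) => [->|->] [->|->] //; rewrite eqxx (negPf neq).
- by move=> i; rewrite !in_Blk; case: (kap2 i) => ->; rewrite eqxx.
- rewrite -natrD !card_Blk //.
  have -> : (nth 0 c j + nth 0 c k)%N = n.
    rewrite -size_ab -sumn_cat; case: (c) c2 => [|u [|v []]] //= _.
    by case: j k neq lt_j lt_k {hj hk ltj ltk x y kap2} => [|[]] // [|[]] //= _ _ _; lia.
  by [].
Qed.

(** H is the whole symmetric group, so an equivariant function is determined by its value at 1. *)
Lemma one_block_rank : (size c <= 1)%N ->
  \rank (cyclic_mx (regular_repr F (SymG n)) (young_elt F n alpha beta)) = 1%N.
Proof.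
move=> c1; rewrite young_eltE.
apply/eqP; rewrite eqn_leq lt0n mxrank_eq0 cyclic_mx_eq0 chi_elt_neq0 // andbT.
have HT h : h \in H.
  apply/colour_groupP => i.
  have lt k : (kap k < size c)%N by apply: blk_lt_size; rewrite sumn_cat size_ab.
  by have := lt i; have := lt (h i); lia.
apply: leq_trans (rank_leq_row (chi_elt H chi)); apply: mxrankS.
apply/row_subP => i; set v := row i _.
have /(mem_induced chi1 chiM) semi : (v <= cyclic_mx (regular_repr F (SymG n)) (chi_elt H chi))%MS.
  exact: row_sub.
have -> : v = gcoef v 1%g *: chi_elt H chi.
  by apply: gcoefP => g; rewrite gcoefZ gcoef_gvec HT -{1}[g]mulg1 semi // mulrC.
exact: scalemx_sub.
Qed.

End SignedYoungModule.

(** * Shapes *)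

Lemma End_iso_F_dim1 (F : fieldType) (gT : finGroupType) (G : {group gT}) (d : nat)
    (rG : mx_representation F G d) : d = 1%N -> End_iso_F rG.
Proof. by move=> d1; subst d => f _; exists (f 0 0); apply: mx11_scalar. Qed.

Lemma row_part_size m : (size (row_part m) <= 1)%N.
Proof. by rewrite /row_part; case: ifP. Qed.

(** Parts are positive and weakly decreasing, so if either part is 1 then the second one is, and a +
    1 is a positive multiple of p. *)
Lemma partition_pair_shape p a b : (0 < p)%N -> is_partition [:: a; b] -> (p %| a + b)%N ->
  a = 1%N \/ b = 1%N ->
  exists k, (0 < k)%N /\ [:: a; b] = [:: (k * p).-1; 1%N].
Proof.
rewrite /is_partition /= !andbT => p0 /and3P[ge_ab a0 b0] /dvdnP[k eqk] ab1.
have -> : b = 1%N by case: ab1 => // a1; move: ge_ab b0; rewrite a1 /geq /=; lia.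
exists k; split; first by case: k eqk => //; lia.
by congr [:: _; _]; case: ab1 => ?; move: ge_ab; rewrite /geq /= => ?; lia.
Qed.

Section Shapes.
Variables (p : nat) (alpha beta : seq nat).
Hypotheses (p_prime : prime p) (p_odd : odd p).
Hypotheses (alpha_part : is_partition alpha) (beta_part : is_partition beta).
Local Notation c := (alpha ++ beta).
Local Open Scope nat_scope.

(** If every pair among three parts contains a 1, two of them equal 1, and p would divide 2. *)
Lemma same_triple x y z : p %| x + y -> p %| x + z -> p %| y + z ->
  x = 1 \/ y = 1 -> x = 1 \/ z = 1 -> y = 1 \/ z = 1 -> False.
Proof.
have p2 : p %| 2 -> False by rewrite gtnNdvd // odd_prime_gt2.
by move=> h1 h2 h3 [] e1 [] e2 [] e3; subst; apply: p2.
Qed.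

(** Adding the last two divisibilities and removing a + b gives p | 2x, so p divides x and hence
    both a and b, one of which is 1. *)
Lemma mixed_triple a b x : p %| a + b -> a = 1 \/ b = 1 ->
  p %| a + x -> p %| b + x -> False.
Proof.
move=> pab ab1 pax pbx.
have p2x : p %| 2 * x.
  rewrite -(dvdn_addl _ pab); have -> : 2 * x + (a + b) = (a + x) + (b + x) by lia.
  exact: dvdn_add.
have px : p %| x.
  move: p2x; rewrite Euclid_dvdM // => /orP[] //.
  by rewrite gtnNdvd // odd_prime_gt2.
have p1 : p %| 1.
  by rewrite (dvdn_addl _ px) in pax; rewrite (dvdn_addl _ px) in pbx; case: ab1 => <-.
by have := prime_gt1 p_prime; rewrite dvdn1 in p1; rewrite (eqP p1).
Qed.

Hypothesis same : forall j k, j < size c -> k < size c -> j != k ->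
  (size alpha <= j) = (size alpha <= k) ->
  p %| nth 0 c j + nth 0 c k /\ (nth 0 c j = 1 \/ nth 0 c k = 1).
Hypothesis mixed : forall j k, j < size alpha -> size alpha <= k < size c ->
  p %| nth 0 c j + nth 0 c k.

Lemma shape_cases :
  (exists m n' : nat,
      [/\ alpha = row_part m, beta = row_part n' & [\/ m = 0, n' = 0 | p %| m + n']]) \/
  (exists k : nat, 0 < k /\
      ((alpha = [:: (k * p).-1; 1] /\ beta = [::]) \/
       (alpha = [::] /\ beta = [:: (k * p).-1; 1]))).
Proof.
have p0 := prime_gt0 p_prime.
have row1 x s : is_partition (x :: s) -> row_part x = [:: x].
  by rewrite /is_partition /row_part /= => /and3P[_ ]; case: (x).
(* Each partition has zero, one, two or at least three parts. Three parts on one side contradict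
   [same_triple]; two on one side and any on the other contradict [mixed_triple]. *)
case: alpha beta alpha_part beta_part same mixed => [|a [|b [|d s]]] [|x [|y [|z t]]] pa pb S M.
- by left; exists 0, 0; split=> //; constructor 1.
- by left; exists 0, x; rewrite (row1 _ _ pb); split=> //; constructor 1.
- have [pxy xy1] := S 0 1 isT isT isT erefl; right.
  by have [k [k0 E]] := partition_pair_shape p0 pb pxy xy1; exists k; split=> //; right.
- have [h1 e1] := S 0 1 isT isT isT erefl; have [h2 e2] := S 0 2 isT isT isT erefl.
  by have [h3 e3] := S 1 2 isT isT isT erefl; case: (same_triple h1 h2 h3 e1 e2 e3).
- by left; exists a, 0; rewrite (row1 _ _ pa); split=> //; constructor 2.
- left; exists a, x; rewrite (row1 _ _ pa) (row1 _ _ pb); split=> //; constructor 3.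
  exact: M 0 1 isT isT.
- have [h1 e1] := S 1 2 isT isT isT erefl.
  by case: (@mixed_triple x y a h1 e1); rewrite addnC; [apply: M 0 1 isT isT | apply: M 0 2 isT isT].
- have [h1 e1] := S 1 2 isT isT isT erefl.
  by case: (@mixed_triple x y a h1 e1); rewrite addnC; [apply: M 0 1 isT isT | apply: M 0 2 isT isT].
- have [pab ab1] := S 0 1 isT isT isT erefl; right.
  by have [k [k0 E]] := partition_pair_shape p0 pa pab ab1; exists k; split=> //; left.
1-3: have [h1 e1] := S 0 1 isT isT isT erefl;
  by case: (@mixed_triple a b x h1 e1 (M 0 2 isT isT) (M 1 2 isT isT)).
all: have [h1 e1] := S 0 1 isT isT isT erefl; have [h2 e2] := S 0 2 isT isT isT erefl;
  by have [h3 e3] := S 1 2 isT isT isT erefl; case: (same_triple h1 h2 h3 e1 e2 e3).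
Qed.
End Shapes.

(** * Classification and endomorphism rings *)

Unset Implicit Arguments.

Theorem theorem1p4 (F : fieldType) (p : nat) (p_prime : prime p) (p_odd : odd p)
    (charFp : p \in [pchar F]) (n : nat) (alpha beta : seq nat)
    (alpha_part : is_partition alpha) (beta_part : is_partition beta)
    (size_ab : (sumn alpha + sumn beta)%N = n) :
  let rM := Mrep F n alpha beta in
  let case_i := exists m n' : nat,
      [/\ alpha = row_part m, beta = row_part n' &
          [\/ m = 0%N, n' = 0%N | (p %| m + n')%N]] in
  let case_iab := exists m n' : nat,
      [/\ alpha = row_part m, beta = row_part n' & m = 0%N \/ n' = 0%N] in
  let case_ii := exists k : nat, (0 < k)%N /\
      ((alpha = [:: (k * p).-1; 1%N] /\ beta = [::]) \/
       (alpha = [::] /\ beta = [:: (k * p).-1; 1%N])) in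
  [/\ mx_indecomposable rM <-> case_i \/ case_ii,
      case_iab -> End_iso_F rM
    & (case_i \/ case_ii) /\ ~ case_iab -> End_iso_dual rM].
Proof.
move=> rM case_i case_iab case_ii.
have p_gt2 : (2 < p)%N by apply: odd_prime_gt2.
have natF0 m : (m%:R == 0 :> F) = (p %| m)%N by rewrite -(dvdn_pcharf charFp).
have nz2 : (2 : F) != 0 by rewrite natF0 gtnNdvd.
have c_pos : all (fun x => 0 < x)%N (alpha ++ beta).
  by rewrite all_cat; move: alpha_part beta_part => /andP[_ ->] /andP[_ ->].
have rank1 : case_iab ->
    \rank (cyclic_mx (regular_repr F (SymG n)) (young_elt F n alpha beta)) = 1%N.
  case=> m [n' [ea eb m0]]; apply: one_block_rank => //; rewrite ea eb size_cat.
  by case: m0 => ->; rewrite ?addn0 row_part_size.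
have dual : (case_i \/ case_ii) /\ ~ case_iab -> End_iso_dual rM.
  case=> -[[m [n' [ea eb h]]]|[k [k0 h]]] niab.
    have m0 : (0 < m)%N by rewrite lt0n; apply/eqP => m0; apply: niab; exists m, n'; split; auto.
    have n0 : (0 < n')%N by rewrite lt0n; apply/eqP => n0; apply: niab; exists m, n'; split; auto.
    have ea' : alpha = [:: m] by rewrite ea /row_part eqn0Ngt m0.
    have eb' : beta = [:: n'] by rewrite eb /row_part eqn0Ngt n0.
    have pn : (p %| n)%N.
      by case: h => [m1|n1|]; [rewrite m1 in m0|rewrite n1 in n0|rewrite -size_ab ea' eb' /= !addn0].
    apply: (@two_blocks_End F n alpha beta size_ab nz2 c_pos 0 1); rewrite ?ea' ?eb' //.
    - by left.
    - by left.
    - by apply/eqP; rewrite natF0.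
  have kp : (0 < k * p)%N by rewrite muln_gt0 k0 prime_gt0.
  have pn : n%:R = 0 :> F.
    apply/eqP; rewrite natF0 -size_ab.
    by case: h => -[-> ->] /=; rewrite ?addn0 ?add0n addn1 prednK ?dvdn_mull.
  (* The one-point second block takes the character opposite to its neighbour: signed next to a
     trivial block, trivial next to a signed one. *)
  case: h => -[ea eb].
    by apply: (@two_blocks_End F n alpha beta size_ab nz2 c_pos 0 1); rewrite ?ea ?eb //; [left|right].
  by apply: (@two_blocks_End F n alpha beta size_ab nz2 c_pos 1 0); rewrite ?ea ?eb //; [right|left].
have iabF : case_iab -> End_iso_F rM by move=> /rank1; apply: End_iso_F_dim1.
have iabI : case_iab -> mx_indecomposable rM.
  by move=> iab; apply: End_iso_F_indecomposable; [rewrite rank1 | apply: iabF].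
split=> //; split=> [indec|cases]; last first.
  (* Decided from the shape: test m and n' for zero in case (i), and note that case (ii) has a
     partition with two parts. *)
  have [iab|niab] : case_iab \/ ~ case_iab.
    case: cases => [[m [n' [ea eb h]]]|[k [k0 h]]].
      have [m0|m0] := eqVneq m 0%N; first by left; exists m, n'; split; auto.
      have [n0|n0] := eqVneq n' 0%N; first by left; exists m, n'; split; auto.
      right=> -[m1 [n1 [ea1 eb1 [] h1]]].
        by move: ea; rewrite ea1 h1 /row_part (negPf m0).
      by move: eb; rewrite eb1 h1 /row_part (negPf n0).
    right=> -[m1 [n1 [ea1 eb1 _]]].
    have := row_part_size m1; have := row_part_size n1; rewrite -ea1 -eb1.
    by case: h => -[-> ->].
  - exact: iabI.
  - by apply: End_iso_dual_indecomposable; apply: dual.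
apply: shape_cases => // [j k lj lk neq side|j k lj lk].
  have [e0 e1] := same_side_pair size_ab nz2 c_pos indec lj lk neq side.
  by rewrite -natF0 e0 eqxx.
by rewrite -natF0; apply/eqP; apply: (mixed_pair size_ab nz2 c_pos indec).
Qed.
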